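(* Let $n,k\ge 1$, let $Q_1,\dots,Q_k\in\mathbb{R}^{n\times n}$ be symmetric positive definite matrices, and let $\mathcal{H}=\bigoplus_{i=1}^k\mathcal{E}(Q_i)$ be the geometric (Minkowski) sum of the corresponding ellipsoids. Let $\ell\in\mathbb{R}^n$ be a unit vector and put $$Q_\ell=\left(\sum_{i=1}^k\langle \ell,Q_i\ell\rangle^{\frac12}\right)\left(\sum_{i=1}^k\langle \ell,Q_i\ell\rangle^{-\frac12}Q_i\right),\qquad x_\ell=\sum_{i=1}^k\langle \ell,Q_i\ell\rangle^{-\frac12}Q_i\ell .$$ Then the ellipsoids $\mathcal{E}(Q)$ (with $Q$ symmetric positive definite) which satisfy $\mathcal{H}\subseteq\mathcal{E}(Q)$ and touch the boundary of $\mathcal{H}$ tangentially at the point $x_\ell$ are exactly those with $$Q=Q_0+Q_\ell,$$ where $Q_0\in\mathbb{R}^{n\times n}$ is a symmetric matrix such that 1. $Q_0+Q_\ell$ is positive definite, 2. $\ell\in\ker(Q_0)$, 3. $\langle \tilde\ell,(Q_0+Q_\ell)\tilde\ell\rangle^{\frac12}\ge\sum_{i=1}^k\langle\tilde\ell,Q_i\tilde\ell\rangle^{\frac12}$ for all $\tilde\ell$ in the unit ball $\mathcal{B}_1(0)$ of $\mathbb{R}^n$.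
   Context: For a symmetric positive definite matrix $Q\in\mathbb{R}^{n\times n}$, $\mathcal{E}(Q)=\{\xi\in\mathbb{R}^n : \xi^TQ^{-1}\xi\le 1\}$ is the ellipsoid centered at the origin with shape matrix $Q$. The geometric (Minkowski) sum of sets $\mathcal{S}_1,\dots,\mathcal{S}_k\subset\mathbb{R}^n$ is $\bigoplus_{i=1}^k\mathcal{S}_i=\{s_1+\cdots+s_k : s_i\in\mathcal{S}_i\}$. $\langle\cdot,\cdot\rangle$ is the Euclidean inner product and $\mathcal{B}_1(0)$ is the unit ball centered at the origin. That $\mathcal{E}(Q)\supseteq\mathcal{H}$ touches $\mathcal{H}$ tangentially at $x_\ell$ means that $x_\ell\in\partial\mathcal{H}\cap\partial\mathcal{E}(Q)$ and that the hyperplane through $x_\ell$ with normal vector $\ell$ supports both $\mathcal{H}$ and $\mathcal{E}(Q)$ at $x_\ell$. *)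

(* Defs.v *)
From mathcomp Require Import all_boot all_order all_algebra.
From mathcomp Require Import sesquilinear.
From mathcomp Require Import all_classical all_reals all_analysis.
Set Implicit Arguments.
Unset Strict Implicit.
Unset Printing Implicit Defensive.
Import Order.TTheory GRing.Theory Num.Theory.
Import numFieldNormedType.Exports.
Local Open Scope classical_set_scope.
Local Open Scope ring_scope.

Definition dotv (R : realType) (n : nat) (x y : 'cV[R]_n) : R :=
  (x^T *m y) 0 0.

(* The library norm `|x| on 'cV[R]_n is the sup norm, not the Euclidean one;
   both induce the topology used by [boundary] below. *)
Definition enorm (R : realType) (n : nat) (x : 'cV[R]_n) : R :=
  Num.sqrt (dotv x x).

Definition posdef (R : realType) (n : nat) (Q : 'M[R]_n) : Prop :=
  Q \is symmetricmx /\ forall x : 'cV[R]_n, x != 0 -> 0 < dotv x (Q *m x).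

Definition ellipsoid (R : realType) (n : nat) (Q : 'M[R]_n) : set 'cV[R]_n :=
  [set x | dotv x (invmx Q *m x) <= 1].

Definition minkowski_sum (R : realType) (n k : nat)
    (S : 'I_k -> set 'cV[R]_n) : set 'cV[R]_n :=
  [set x | exists s : 'I_k -> 'cV[R]_n,
     (forall i, S i (s i)) /\ x = \sum_(i < k) s i].

Definition boundary (T : topologicalType) (A : set T) : set T :=
  closure A `\` interior A.

(* Only one of the two closed half-spaces bounded by the hyperplane through [x]
   with normal [l] has to contain [A], so [l] need not point outwards.  The
   contact condition, that [x] is a boundary point of [A], is not included; it
   is part of [touches_tangentially]. *)
Definition supports (R : realType) (n : nat) (l x : 'cV[R]_n)
    (A : set 'cV[R]_n) : Prop :=
  (forall y, A y -> dotv l y <= dotv l x) \/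
  (forall y, A y -> dotv l x <= dotv l y).

Definition touches_tangentially (R : realType) (n : nat) (l x : 'cV[R]_n)
    (H E : set 'cV[R]_n) : Prop :=
  [/\ boundary H x, boundary E x, supports l x H & supports l x E].

Definition Qsum (R : realType) (n k : nat) (Q : 'I_k -> 'M[R]_n)
    (l : 'cV[R]_n) : 'M[R]_n :=
  (\sum_(i < k) Num.sqrt (dotv l (Q i *m l))) *:
  (\sum_(i < k) (Num.sqrt (dotv l (Q i *m l)))^-1 *: Q i).

Definition xsum (R : realType) (n k : nat) (Q : 'I_k -> 'M[R]_n)
    (l : 'cV[R]_n) : 'cV[R]_n :=
  \sum_(i < k) (Num.sqrt (dotv l (Q i *m l)))^-1 *: (Q i *m l).

(* Main.v *)
(* Write h_Q(t) = <t, Q t>^(1/2) for the support function of E(Q); that of the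
   Minkowski sum H is the sum of the h_(Q_i), so H is contained in E(Q) iff
   this sum is at most h_Q, which by homogeneity need only be tested on the
   unit ball.  The point x_l lies in H and maximizes <l, .> there, with value
   c = sum_i h_(Q_i)(l) > 0.  Tangency of E(Q) at x_l therefore means that x_l
   also maximizes <l, .> on E(Q); the maximizer Q l / h_Q(l) being unique, this
   says Q l = c x_l = Q_l l, that is (Q - Q_l) l = 0. *)
Require Import Defs.
From mathcomp Require Import all_boot all_order all_algebra.
From mathcomp Require Import sesquilinear.
From mathcomp Require Import all_classical all_reals all_analysis.
From mathcomp Require Import ring lra.
Import Order.TTheory GRing.Theory Num.Theory.
Import numFieldNormedType.Exports.
Local Open Scope classical_set_scope.
Local Open Scope ring_scope.
Set Implicit Arguments.
Unset Strict Implicit.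
Unset Printing Implicit Defensive.

(** [symmetricmx] is the Hermitian predicate with sign [(-1) ^+ 0] and the identity as automorphism;
    both are stripped here. *)
Lemma symmetricmxP (R : realType) (n : nat) (Q : 'M[R]_n) :
  reflect (Q^T = Q) (Q \is symmetricmx).
Proof.
have idE : map_mx idfun Q^T = Q^T by apply/matrixP=> i j; rewrite !mxE.
by apply: (iffP (is_hermitianmxP _ _ _)); rewrite idE expr0 scale1r.
Qed.

(** * Bilinear calculus for the Euclidean inner product *)

Section InnerProduct.
Variables (R : realType) (n : nat).
Implicit Types (x y z : 'cV[R]_n) (Q : 'M[R]_n) (a : R).

Lemma dotvC x y : dotv x y = dotv y x.
Proof. by rewrite /dotv !mxE; apply: eq_bigr => i _; rewrite !mxE mulrC. Qed.

Lemma dotvDr x y z : dotv x (y + z) = dotv x y + dotv x z.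
Proof. by rewrite /dotv mulmxDr mxE. Qed.

Lemma dotvZr a x y : dotv x (a *: y) = a * dotv x y.
Proof. by rewrite /dotv -scalemxAr mxE. Qed.

Lemma dotvZl a x y : dotv (a *: x) y = a * dotv x y.
Proof. by rewrite dotvC dotvZr dotvC. Qed.

Lemma dotvBr x y z : dotv x (y - z) = dotv x y - dotv x z.
Proof. by rewrite -scaleN1r dotvDr dotvZr mulN1r. Qed.

Lemma dotvBl x y z : dotv (x - y) z = dotv x z - dotv y z.
Proof. by rewrite dotvC dotvBr !(dotvC z). Qed.

Lemma dotv0r x : dotv x 0 = 0.
Proof. by rewrite -(scale0r 0) dotvZr mul0r. Qed.

Lemma dotv_sumr k x (f : 'I_k -> 'cV[R]_n) :
  dotv x (\sum_(i < k) f i) = \sum_(i < k) dotv x (f i).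
Proof. by rewrite /dotv mulmx_sumr summxE. Qed.

Lemma dotv_gt0 x : x != 0 -> 0 < dotv x x.
Proof.
have ge0 i : true -> 0 <= x^T 0 i * x i 0 by rewrite mxE -expr2 sqr_ge0.
move=> x0; rewrite /dotv mxE lt0r sumr_ge0// andbT.
apply: contra x0; rewrite psumr_eq0// => /allP x0.
apply/eqP/matrixP => i j; rewrite (ord1 j) mxE.
by have := x0 i (mem_index_enum i); rewrite mxE mulf_eq0 orbb => /eqP.
Qed.

Lemma dotv_mulmx_sym Q x y :
  Q \is symmetricmx -> dotv x (Q *m y) = dotv y (Q *m x).
Proof.
by move=> /symmetricmxP QT; rewrite dotvC /dotv trmx_mul QT mulmxA.
Qed.

End InnerProduct.

(** * Support function and maximizer of a single ellipsoid *)

Section Ellipsoid.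
Variables (R : realType) (n : nat).
Implicit Types (x y t : 'cV[R]_n) (Q : 'M[R]_n).

Lemma posdef_unitmx Q : posdef Q -> Q \in unitmx.
Proof.
move=> [/symmetricmxP QT Qpos]; rewrite unitmxE unitfE.
apply/det0P => -[v v0 vQ].
have : v^T != 0 by rewrite trmx_eq0.
(* By symmetry the left kernel vector [v] is also a right one, so the form would vanish at [v^T]. *)
by move/Qpos; rewrite -[Q in Q *m _]QT -trmx_mul vQ trmx0 dotv0r ltxx.
Qed.

Lemma posdef_ge0 Q x : posdef Q -> 0 <= dotv x (Q *m x).
Proof.
move=> [_ Qpos]; have [->|/Qpos/ltW//] := eqVneq x 0.
by rewrite mulmx0 dotv0r.
Qed.

Lemma sqrt_form_gt0 Q x :
  posdef Q -> x != 0 -> 0 < Num.sqrt (dotv x (Q *m x)).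
Proof. by move=> [_ Qpos] x0; rewrite sqrtr_gt0 Qpos. Qed.

Lemma sqrt_form_scale Q a x : 0 <= a ->
  Num.sqrt (dotv (a *: x) (Q *m (a *: x))) = a * Num.sqrt (dotv x (Q *m x)).
Proof.
move=> a0; rewrite -scalemxAr dotvZl dotvZr mulrA -expr2 sqrtrM ?sqr_ge0//.
by rewrite sqrtr_sqr ger0_norm.
Qed.

(* Quantitative Cauchy-Schwarz: nonnegativity of the left-hand side bounds the
   support function, and its vanishing gives uniqueness of the maximizer. *)
Lemma ellipsoid_gap Q t y (s := Num.sqrt (dotv t (Q *m t)))
    (v := invmx Q *m y - s^-1 *: t) :
  posdef Q -> t != 0 -> ellipsoid Q y ->
  dotv v (Q *m v) <= 2 * (1 - s^-1 * dotv t y).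
Proof.
move=> Qpd t0; rewrite /ellipsoid /= => Ey.
have sgt0 : 0 < s by exact: sqrt_form_gt0.
have ss : dotv t (Q *m t) = s ^+ 2 by rewrite sqr_sqrtr// posdef_ge0.
(* The left-hand side expands to [dotv y (invmx Q *m y) - 2 * s^-1 * dotv t y + 1], whose first term
   is at most 1 by [Ey]. *)
rewrite /v mulmxBr mulKVmx ?posdef_unitmx// -scalemxAr.
rewrite dotvBr !dotvBl !dotvZr !dotvZl ss [dotv (_ *m y) (_ *m _)]dotv_mulmx_sym;
  last by case: Qpd.
rewrite mulKVmx ?posdef_unitmx// [dotv _ y]dotvC.
have -> : s^-1 * (s^-1 * s ^+ 2) = 1 by field; rewrite gt_eqF.
lra.
Qed.

Lemma ellipsoid_support_le Q t y : posdef Q -> ellipsoid Q y ->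
  dotv t y <= Num.sqrt (dotv t (Q *m t)).
Proof.
move=> Qpd Ey; have [->|t0] := eqVneq t 0.
  by rewrite dotvC dotv0r sqrtr_ge0.
have := le_trans (posdef_ge0 _ Qpd) (ellipsoid_gap Qpd t0 Ey).
rewrite pmulr_rge0// subr_ge0 mulrC ler_pdivrMr ?mul1r//.
exact: sqrt_form_gt0.
Qed.

Lemma ellipsoid_support_eq Q t y : posdef Q -> t != 0 -> ellipsoid Q y ->
  Num.sqrt (dotv t (Q *m t)) <= dotv t y ->
  Q *m t = Num.sqrt (dotv t (Q *m t)) *: y.
Proof.
move=> Qpd t0 Ey le_ty; have := ellipsoid_gap Qpd t0 Ey.
set s := Num.sqrt _ in le_ty *; set v := _ - _ => vle.
have sgt0 : 0 < s by exact: sqrt_form_gt0.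
have v0 : v = 0.
  apply/eqP; apply: contraT => /(proj2 Qpd); rewrite ltNge.
  rewrite (le_trans vle)// pmulr_rle0// subr_le0 mulrC ler_pdivlMr//.
  by rewrite mul1r.
have /(congr1 (mulmx Q)) : invmx Q *m y = s^-1 *: t by apply/subr0_eq.
rewrite mulKVmx ?posdef_unitmx// => ->.
by rewrite -scalemxAr scalerA mulfV ?scale1r// gt_eqF.
Qed.

(** For [t != 0], the maximizer of [dotv t] on [ellipsoid Q]; [xsum] adds up these points. *)
Definition support_point Q t :=
  (Num.sqrt (dotv t (Q *m t)))^-1 *: (Q *m t).

Lemma dotv_support_point Q t : posdef Q -> t != 0 ->
  dotv t (support_point Q t) = Num.sqrt (dotv t (Q *m t)).
Proof.
move=> Qpd t0; have sgt0 := sqrt_form_gt0 Qpd t0.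
rewrite dotvZr -{2}(sqr_sqrtr (posdef_ge0 t Qpd)).
by field; rewrite gt_eqF.
Qed.

Lemma ellipsoid_support_point Q t : posdef Q -> t != 0 ->
  ellipsoid Q (support_point Q t).
Proof.
move=> Qpd t0; have sgt0 := sqrt_form_gt0 Qpd t0.
have invE : invmx Q *m support_point Q t = (Num.sqrt (dotv t (Q *m t)))^-1 *: t.
  by rewrite -scalemxAr mulKmx ?posdef_unitmx.
rewrite /ellipsoid /= invE.
by rewrite dotvZr (dotvC _ t) dotv_support_point// mulVf// gt_eqF.
Qed.

Lemma boundary_of_max t x (A : set 'cV[R]_n) : t != 0 -> A x ->
  (forall y, A y -> dotv t y <= dotv t x) -> boundary A x.
Proof.
move=> t0 Ax maxx; split; first exact: subset_closure.
move=> intx.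
(* Restricting to the line through [x] along [t] needs only a ball in [R]; a small step along [t]
   stays in [A] yet increases [dotv t]. *)
have cvx : (fun a : R => x + a *: t) a @[a --> 0] --> x.
  have : (fun a : R => x + a *: t) a @[a --> 0] --> x + 0 *: t.
    apply: cvgD; first exact: cvg_cst.
    by apply: cvgZr_tmp; exact: cvg_id.
  by rewrite scale0r addr0.
have /nbhs_ballP[e /= e0 He] := cvx _ intx.
have /maxx : A (x + (e / 2) *: t).
  apply: He; rewrite -ball_normE /= sub0r normrN gtr0_norm ?divr_gt0//.
  by rewrite ltr_pdivrMr// ltr_pMr// ltr1n.
rewrite dotvDr dotvZr gerDl pmulr_rle0 ?divr_gt0// leNgt.
by rewrite dotv_gt0.
Qed.

End Ellipsoid.

(** * Support function of the Minkowski sum and the inclusion test *)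

Section MinkowskiSum.
Variables (R : realType) (n k : nat) (Qs : 'I_k -> 'M[R]_n).
Hypothesis Qs_pd : forall i, posdef (Qs i).
Let H := minkowski_sum (fun i => ellipsoid (Qs i)).
Implicit Types (t x : 'cV[R]_n) (Q : 'M[R]_n).
Let h t := \sum_(i < k) Num.sqrt (dotv t (Qs i *m t)).

Lemma minkowski_support_le t x : H x -> dotv t x <= h t.
Proof.
move=> [s [Es ->]]; rewrite dotv_sumr; apply: ler_sum => i _.
exact: ellipsoid_support_le.
Qed.

Lemma minkowski_xsum t : t != 0 -> H (xsum Qs t).
Proof.
move=> t0; exists (fun i => support_point (Qs i) t); split=> // i.
exact: ellipsoid_support_point.
Qed.

Lemma dotv_xsum t : t != 0 -> dotv t (xsum Qs t) = h t.
Proof.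
move=> t0; rewrite dotv_sumr; apply: eq_bigr => i _.
exact: dotv_support_point.
Qed.

Lemma minkowski_sub_ellipsoid Q : posdef Q ->
  H `<=` ellipsoid Q <->
  forall t, enorm t <= 1 -> h t <= Num.sqrt (dotv t (Q *m t)).
Proof.
move=> Qpd; split=> [HQ t _|hQ x Hx].
  have [->|t0] := eqVneq t 0.
    rewrite /h big1 ?sqrtr_ge0// => i _.
    by rewrite mulmx0 dotv0r sqrtr0.
  rewrite -dotv_xsum//; apply: ellipsoid_support_le => //.
  exact/HQ/minkowski_xsum.
have hQ' t : h t <= Num.sqrt (dotv t (Q *m t)).
  have [t1|t1] := leP (enorm t) 1; first exact: hQ.
  have t0 : 0 < enorm t by exact: lt_trans t1.
  have ti : 0 <= (enorm t)^-1 by rewrite invr_ge0 ltW.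
  have : enorm ((enorm t)^-1 *: t) <= 1.
    (* [enorm] is the case of the identity matrix, so the same homogeneity applies. *)
    have := sqrt_form_scale 1%:M t ti; rewrite !mul1mx /enorm => ->.
    by rewrite mulVf// gt_eqF.
  move/hQ; rewrite /h sqrt_form_scale//.
  under eq_bigr do rewrite sqrt_form_scale//.
  by rewrite -mulr_sumr ler_pM2l// invr_gt0.
(* For [t = Q^-1 x] both [<t, x>] and [<t, Q t>] equal [x^T Q^-1 x]. *)
have := le_trans (minkowski_support_le (invmx Q *m x) Hx) (hQ' _).
rewrite mulKVmx ?posdef_unitmx// (dotvC _ x) /ellipsoid /=.
have : 0 <= dotv x (invmx Q *m x).
  have := posdef_ge0 (invmx Q *m x) Qpd.
  by rewrite mulKVmx ?posdef_unitmx// dotvC.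
move: (dotv _ _) => a a0 le_a.
(* Now [le_a] bounds [a] by its square root, which is impossible for [a > 1]. *)
rewrite leNgt; apply/negP => a1; move: le_a; apply/negP; rewrite -ltNge.
rewrite -{2}(sqr_sqrtr a0) expr2 ltr_pMr ?sqrtr_gt0 ?(lt_trans _ a1)//.
by rewrite -[ltLHS]sqrtr1 ltr_sqrt// (lt_trans _ a1).
Qed.

Lemma Qsum_symmetric t : Qsum Qs t \is symmetricmx.
Proof.
have trZ a (M : 'M[R]_n) : (a *: M)^T = a *: M^T.
  by apply/matrixP => i j; rewrite !mxE.
apply/symmetricmxP; rewrite /Qsum trZ raddf_sum /=; congr (_ *: _).
apply: eq_bigr => i _; rewrite trZ; congr (_ *: _).
by apply/symmetricmxP; case: (Qs_pd i).
Qed.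

Lemma Qsum_mul t : Qsum Qs t *m t = h t *: xsum Qs t.
Proof.
rewrite /Qsum -scalemxAl mulmx_suml; congr (_ *: _).
by apply: eq_bigr => i _; rewrite -scalemxAl.
Qed.

End MinkowskiSum.

Theorem corollary3 (R : realType) (n k : nat) (Qs : 'I_k -> 'M[R]_n)
    (l : 'cV[R]_n) :
  (1 <= n)%N -> (1 <= k)%N ->
  (forall i, posdef (Qs i)) ->
  enorm l = 1 ->
  let H := minkowski_sum (fun i => ellipsoid (Qs i)) in
  let Ql := Qsum Qs l in
  let xl := xsum Qs l in
  forall Q : 'M[R]_n,
    [/\ posdef Q,
        H `<=` ellipsoid Q
      & touches_tangentially l xl H (ellipsoid Q)] <->
    exists Q0 : 'M[R]_n,
      [/\ Q0 \is symmetricmx,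
          Q = Q0 + Ql,
          posdef (Q0 + Ql),
          Q0 *m l = 0
        & forall t : 'cV[R]_n, enorm t <= 1 ->
            \sum_(i < k) Num.sqrt (dotv t (Qs i *m t))
              <= Num.sqrt (dotv t ((Q0 + Ql) *m t))].
Proof.
move=> _ k1 Qs_pd l1 H Ql xl Q.
have l0 : l != 0.
  apply: contra_eq_neq l1 => ->; rewrite /enorm dotv0r sqrtr0.
  by rewrite eq_sym oner_neq0.
have Hxl : H xl by exact: minkowski_xsum.
have lxl := dotv_xsum Qs_pd l0; rewrite -/xl in lxl.
have Ql_l := Qsum_mul Qs l; rewrite -/Ql -/xl -lxl in Ql_l.
have c0 : 0 < dotv l xl.
  (* [k >= 1] supplies one positive summand; the others are nonnegative. *)
  rewrite lxl; case: k k1 Qs Qs_pd {H Ql xl Hxl lxl Ql_l} => // m _ P P_pd.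
  rewrite big_ord_recl ltr_wpDr ?sqrt_form_gt0// sumr_ge0//.
split=> [[Qpd HQ [_ _ _ suppE]]|[Q0 [Q0sym -> Qpd Q0l hQ]]].
  have le_c : Num.sqrt (dotv l (Q *m l)) <= dotv l xl.
    case: suppE => suppE.
      rewrite -dotv_support_point//; apply: suppE.
      exact: ellipsoid_support_point.
    (* The opposite half-space is excluded: the origin lies in the ellipsoid, which would force
       [dotv l xl <= 0]. *)
    suff /suppE : ellipsoid Q 0 by rewrite dotv0r leNgt c0.
    by rewrite /ellipsoid /= mulmx0 dotv0r ler01.
  have cE : Num.sqrt (dotv l (Q *m l)) = dotv l xl.
    by apply/le_anti; rewrite le_c ellipsoid_support_le//; apply: HQ.
  exists (Q - Ql); rewrite subrK; split=> //.
  - apply/symmetricmxP; rewrite raddfB /=; congr (_ - _); apply/symmetricmxP.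
      by case: Qpd.
    exact: Qsum_symmetric.
  - rewrite mulmxBl Ql_l (ellipsoid_support_eq Qpd l0 (HQ _ Hxl) le_c) cE.
    exact: subrr.
  - exact/minkowski_sub_ellipsoid.
have HQ : H `<=` ellipsoid (Q0 + Ql) by apply/minkowski_sub_ellipsoid.
(* Since [Q0 *m l = 0], the form of [Q0 + Ql] at [l] is [dotv l xl ^+ 2], so the support value at
   [l] is [dotv l xl]. *)
have maxE y : ellipsoid (Q0 + Ql) y -> dotv l y <= dotv l xl.
  move/(ellipsoid_support_le l Qpd); rewrite mulmxDl Q0l add0r Ql_l.
  by rewrite dotvZr -expr2 sqrtr_sqr gtr0_norm.
have maxH y : H y -> dotv l y <= dotv l xl by move/HQ/maxE.
split=> //; split; [| |by left|by left].
- exact: boundary_of_max maxH.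
- exact: boundary_of_max (HQ _ Hxl) maxE.
Qed.
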